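(* Let $G=(V,E)$ be a finite simple connected graph and let $F:\mathbb F_2^{V}\to \mathbb F_2^{V}$ be the map given by $F(s)=sP_s+P_s+s+1$, where $P_s(v)=\prod_{x\in N(v)}(1+s(x))$ for $v\in V$. Then the set of all periodic points of $F$ in $\mathrm{Surj}(\mathbb F_2^{V})$ is nonempty, and every periodic point of $F$ in $\mathrm{Surj}(\mathbb F_2^{V})$ has period $2$. Moreover, the orbit space of these periodic points under the involution induced by $F$ is in one-to-one correspondence with the set of all domatic-$2$-partitions of $G$.
   Context: Graphs are undirected. $\mathbb F_2=\{0,1\}$ is the field with two elements and $\mathbb F_2^{V}$ is the set of functions (''configurations'') $V\to\mathbb F_2$, with pointwise addition and multiplication; $1$ denotes the constant function $1$. $N(v)=\{x\in V : vx\in E\}$ is the open neighborhood of $v$. $c_i$ is the constant function with value $i\in\{0,1\}$, and $\mathrm{Surj}(\mathbb F_2^{V})=\mathbb F_2^{V}\setminus\{c_0,c_1\}$. A point $s$ is periodic for $F$ if $F^n(s)=s$ for some $n\ge 1$; its period is the least such $n$. A dominating set of $G$ is a subset $D\subseteq V$ such that every vertex not in $D$ is adjacent to a vertex in $D$. A domatic-$2$-partition of $G$ is a partition $\{D,B\}$ of $V$ into two disjoint dominating sets.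
   Formalization: Nonemptiness of the set of periodic points in Surj is claimed only for graphs with at least two vertices, since for the one-vertex graph Surj is empty; all other claims are stated for every finite simple connected graph. *)

(* Defs.v *)
From mathcomp Require Import all_boot all_order all_algebra.
From mathcomp Require Import boolp.

Set Implicit Arguments.
Unset Strict Implicit.
Unset Printing Implicit Defensive.

Import GRing.Theory.
Local Open Scope ring_scope.

Definition neighborhood (V : finType) (e : rel V) (v : V) : {set V} :=
  [set x | e v x].

Definition nbr_prod (V : finType) (e : rel V) (s : {ffun V -> 'F_2}) :
    {ffun V -> 'F_2} :=
  [ffun v => \prod_(x in neighborhood e v) (1 + s x)].

(* The operations and the constant 1 are those of the pointwise ring structure
   that the library puts on [{ffun V -> 'F_2}]. *)
Definition update (V : finType) (e : rel V) (s : {ffun V -> 'F_2}) :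
    {ffun V -> 'F_2} :=
  s * nbr_prod e s + nbr_prod e s + s + 1.

Definition cst_conf (V : finType) (i : 'F_2) : {ffun V -> 'F_2} := [ffun=> i].

Definition Surj (V : finType) : {set {ffun V -> 'F_2}} :=
  ~: [set cst_conf V 0; cst_conf V 1].

Definition periodic (T : Type) (F : T -> T) (s : T) : Prop :=
  exists2 n : nat, (1 <= n)%N & iter n F s = s.

Definition has_period (T : Type) (F : T -> T) (s : T) (p : nat) : Prop :=
  [/\ (1 <= p)%N, iter p F s = s &
      forall n : nat, (1 <= n)%N -> iter n F s = s -> (p <= n)%N].

Definition periodic_surj (V : finType) (e : rel V) :
    {set {ffun V -> 'F_2}} :=
  [set s in Surj V | `[< periodic (update e) s >]].

Definition orbit_space (T : finType) (F : T -> T) (A : {set T}) :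
    {set {set T}} :=
  [set [set t in orbit F s] | s in A].

Definition dominating (V : finType) (e : rel V) (D : {set V}) : bool :=
  [forall v, (v \notin D) ==> [exists u in D, e v u]].

(* Unordered partitions {D, B}, hence sets of two blocks. The library's
   [partition] has nonempty blocks, which is automatic for dominating sets
   unless the graph has no vertex. *)
Definition domatic_2_partitions (V : finType) (e : rel V) :
    {set {set {set V}}} :=
  [set Q : {set {set V}} | [&& partition Q [set: V], #|Q| == 2%N
                             & [forall D in Q, dominating e D]]].

Definition one_to_one_correspondence (T U : finType)
    (A : {set T}) (B : {set U}) : Prop :=
  exists f : T -> U, {in A &, injective f} /\ f @: A = B.

(* Main.v *)
Require Import Defs.
From mathcomp Require Import all_boot all_order all_algebra.
From mathcomp Require Import boolp.

Set Implicit Arguments.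
Unset Strict Implicit.
Unset Printing Implicit Defensive.

Import GRing.Theory.
Local Open Scope ring_scope.

(** Since [F s = (s + 1) (P_s + 1)], on supports [F] is the map sending [A] to
    the set [step A] of vertices outside [A] with a neighbour in [A]. A vertex
    of [step A] has a neighbour in [A], which belongs to [step (step A)]; hence
    [step A] is included in [step (step (step A))], and along a periodic orbit
    the supports of [s] and [F (F s)] agree. The vertices outside both [A] and
    [step A] then form a set closed under adjacency, which by connectedness is
    empty unless [A] is. So the periodic points in [Surj] are the indicators of
    the sets [A] such that [A] and its complement dominate, and [F] exchanges
    the two. Such an [A] exists: take a maximal independent set. *)

Lemma F2_neq0 (x : 'F_2) : (x != 0) = (x == 1).
Proof. by case: x => [[|[|]]]. Qed.

(** * Configurations as vertex sets *)

Section Support.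

Variable V : finType.
Implicit Types (s : {ffun V -> 'F_2}) (A : {set V}).

Definition supp s : {set V} := [set v | s v == 1].

Definition indicator A : {ffun V -> 'F_2} := [ffun v => (v \in A)%:R].

Lemma indicatorK : cancel indicator supp.
Proof. by move=> A; apply/setP => v; rewrite inE ffunE; case: (v \in A). Qed.

Lemma suppK : cancel supp indicator.
Proof.
move=> s; apply/ffunP => v; rewrite ffunE inE.
by case: eqP => [-> //|/eqP]; rewrite -F2_neq0 negbK => /eqP.
Qed.

Lemma supp_cst0 : supp (cst_conf V 0) = set0.
Proof. by apply/setP => v; rewrite !inE ffunE. Qed.

Lemma supp_cst1 : supp (cst_conf V 1) = setT.
Proof. by apply/setP => v; rewrite !inE ffunE. Qed.

Lemma in_SurjE s : (s \in Surj V) = (supp s != set0) && (supp s != setT).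
Proof.
by rewrite !inE negb_or -supp_cst0 -supp_cst1 !(inj_eq (can_inj suppK)).
Qed.

End Support.

(** * The map on supports and domination *)

Section Step.

Variables (V : finType) (e : rel V).
Implicit Types (s : {ffun V -> 'F_2}) (A : {set V}).

Definition step A : {set V} := [set v | (v \notin A) && [exists u in A, e v u]].

Lemma stepP A v :
  reflect (v \notin A /\ exists2 u, u \in A & e v u) (v \in step A).
Proof.
rewrite inE; apply: (iffP andP) => -[vA].
  by case/exists_inP=> u uA vu; split=> //; exists u.
by case=> u uA vu; split=> //; apply/exists_inP; exists u.
Qed.

Lemma supp_update s : supp (update e s) = step (supp s).
Proof.
apply/setP => v; rewrite !inE -F2_neq0.
have -> : update e s v = (s v + 1) * (nbr_prod e s v + 1).
  by rewrite /update !ffunE mulrDr mulr1 mulrDl mul1r addrA.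
have F2D1_neq0 (x : 'F_2) : (x + 1 != 0) = (x != 1) by case: x => [[|[|]]].
rewrite mulf_eq0 negb_or !F2D1_neq0 -F2_neq0; congr (_ && _).
(* The product at [v] vanishes exactly when some factor [1 + s u] does, that is, when a neighbour
   [u] carries the value 1. *)
rewrite -F2_neq0 negbK ffunE.
apply/prodf_eq0/exists_inP => -[u]; rewrite !inE.
  move=> vu su; exists u => //; rewrite inE.
  by move: su; case: (s u) => [[|[|]]].
by move=> /eqP su vu; exists u; rewrite ?inE // su.
Qed.

Lemma supp_iter_update n s : supp (iter n (update e) s) = iter n step (supp s).
Proof. by elim: n => //= n IHn; rewrite supp_update IHn. Qed.

Lemma step_subC A : step A \subset ~: A.
Proof. by apply/subsetP => v /stepP[vA _]; rewrite inE. Qed.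

(** Turns domination of [A] and of its complement into the statement that [step] exchanges the
    two. *)
Lemma dominatingE A : dominating e A = (step A == ~: A).
Proof.
rewrite eqEsubset step_subC /=; apply/forallP/subsetP => [dom v | sub v].
  by rewrite !inE => vA; rewrite vA (implyP (dom v)).
by apply/implyP => vA; have := sub v; rewrite !inE vA; apply.
Qed.

(** * Periodic sets of the map *)

Hypothesis e_sym : symmetric e.

Lemma step_sub_step3 A : step A \subset step (step (step A)).
Proof.
apply/subsetP => v vS; case/stepP: (vS) => vA [u uA vu].
have uS2 : u \in step (step A).
  apply/stepP; split; last by exists v; rewrite // e_sym.
  by apply/negP => /stepP[]; rewrite uA.
apply/stepP; split; last by exists u.
by apply/negP => /stepP[]; rewrite vS.
Qed.

Lemma periodic_step2 A : periodic step A -> step (step A) = A.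
Proof.
case=> -[//|n] _ eqA; pose g B := step (step B).
(* By periodicity [A] is itself an image under [step], so the inclusion for such images applies to
   it. *)
have Ag : A \subset g A by rewrite -{1 2}eqA /g iterS step_sub_step3.
have g_incr k : g A \subset iter k.+1 g A.
  elim: k => [|k IHk] //; apply: subset_trans IHk _.
  by rewrite /= /g step_sub_step3.
have iter_g k B : iter k g B = iter k step (iter k step B).
  elim: k => //= k ->; rewrite /g; congr step.
  by rewrite -iterS iterSr.
(* Applying [g] as many times as the period [n.+1] runs through the cycle of [step] twice and
   returns to [A], so the increasing chain closes up. *)
have gA : g A \subset A by have := g_incr n; rewrite iter_g !eqA.
by apply/eqP; rewrite eqEsubset gA.
Qed.

Hypothesis e_conn : forall x y : V, connect e x y.

Lemma step2_fixed_setC A : A != set0 -> step (step A) = A -> step A = ~: A.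
Proof.
case/set0Pn=> a aA fixA; apply/eqP; rewrite eqEsubset step_subC /=.
apply/subsetP => v; rewrite inE => vA; apply/negPn/negP => vS.
have closedU : closed e [predC A :|: step A].
  apply: intro_closed => [|x y xy]; first by move=> x y; rewrite !e_conn.
  rewrite !inE => /norP[xA]; rewrite xA /= => xN.
  have xS : x \notin step A by rewrite inE xA.
  apply/norP; split.
    by apply: contra xN => yA; apply/exists_inP; exists y.
  (* A neighbour [y] in [step A] would put [x] into [step (step A)], which is [A]. *)
  apply/negP => yS; case/negP: xA; rewrite -fixA.
  apply/stepP; split=> //; exists y => //.
  by rewrite inE.
have := closed_connect closedU (e_conn a v).
by rewrite !inE aA (negbTE vA) /=; move: vS; rewrite inE vA /= => ->.
Qed.

(** * Periodic points in [Surj] and their orbits *)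

Lemma periodic_surjE s :
  (s \in periodic_surj e) =
  [&& supp s != set0, supp s != setT,
      dominating e (supp s) & dominating e (~: supp s)].
Proof.
rewrite inE in_SurjE -andbA; apply: andb_id2l => s0; apply: andb_id2l => sT.
rewrite !dominatingE setCK; apply/asboolP/andP => [[n n_gt0 sn]|].
  have fix2 : step (step (supp s)) = supp s.
    by apply: periodic_step2; exists n; rewrite // -supp_iter_update sn.
  (* With [step A] equal to the complement, [fix2] itself says that the complement dominates. *)
  by have compl := step2_fixed_setC s0 fix2; rewrite -{2}compl fix2 compl.
case=> /eqP S1 /eqP S2; exists 2 => //; apply: (can_inj (@suppK V)).
by rewrite supp_iter_update /= S1.
Qed.

Lemma supp_update_periodic s :
  s \in periodic_surj e -> supp (update e s) = ~: supp s.
Proof.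
by rewrite periodic_surjE supp_update !dominatingE => /and4P[_ _ /eqP].
Qed.

Lemma update_periodic_surj s :
  s \in periodic_surj e -> update e s \in periodic_surj e.
Proof.
move=> sP; move: (sP); rewrite !periodic_surjE supp_update_periodic // setCK.
case/and4P=> s0 sT -> ->; rewrite -(inj_eq (@setC_inj V)) setCK setC0 sT.
by rewrite -(inj_eq (@setC_inj V)) setCK setCT s0.
Qed.

Lemma update_involutive_periodic s :
  s \in periodic_surj e -> update e (update e s) = s.
Proof.
move=> sP; apply: (can_inj (@suppK V)).
by rewrite !supp_update_periodic ?update_periodic_surj // setCK.
Qed.

Lemma update_neq_periodic s : s \in periodic_surj e -> update e s != s.
Proof.
move=> sP; apply/eqP => /(congr1 (@supp V)); rewrite supp_update_periodic //.
move: sP; rewrite periodic_surjE => /andP[/set0Pn[v vs] _] /setP/(_ v).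
by rewrite in_setC vs.
Qed.

Lemma orbit_update_periodic s :
  s \in periodic_surj e -> [set t in orbit (update e) s] = [set s; update e s].
Proof.
move=> sP; apply/setP => t; rewrite inE -fconnect_orbit !inE.
apply/idP/idP => [/iter_findex <-|/orP[] /eqP ->]; last 2 first.
- exact: connect0.
- exact: fconnect1.
elim: (findex _ _ _) => [|n]; rewrite ?eqxx //= => /orP[] /eqP ->.
  by rewrite eqxx orbT.
by rewrite update_involutive_periodic // eqxx.
Qed.

(** * Orbits and domatic partitions *)

Lemma domatic_2_partitionP (Q : {set {set V}}) :
  reflect
    (exists A, [/\ A != set0, A != setT, dominating e A, dominating e (~: A)
                 & Q = [set A; ~: A]])
    (Q \in domatic_2_partitions e).
Proof.
rewrite inE; apply: (iffP and3P) => [[partQ /cards2P[A [B [AB defQ]]] domQ]|].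
  have [/eqP covQ trivQ Q0] := and3P partQ.
  have AQ : A \in Q by rewrite defQ !inE eqxx.
  have BQ : B \in Q by rewrite defQ !inE eqxx orbT.
  have disjAB : [disjoint A & B] by move/trivIsetP: trivQ; apply.
  have AUB : A :|: B = setT by rewrite -covQ defQ /cover bigcup_setU !big_set1.
  have defB : B = ~: A.
    apply/setP => v; move/setP/(_ v): AUB; rewrite !inE.
    by case: (boolP (v \in A)) => //= vA _; rewrite (disjointFr disjAB).
  have neq0 C : C \in Q -> C != set0 by apply: contraTneq => ->.
  have domC C : C \in Q -> dominating e C by move/(forall_inP domQ).
  exists A; rewrite -defB; split; auto.
  by rewrite -setC0 -(inj_eq (@setC_inj V)) setCK -defB neq0.
case=> A [A0 AT domA domAC ->].
have AC : A != ~: A.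
  by apply/eqP => /setP AC; case/set0Pn: A0 => v vA; have := AC v;
    rewrite inE vA.
split; last 2 first.
- by rewrite cards2 AC.
- by apply/forall_inP => D; rewrite !inE => /orP[] /eqP ->.
apply/and3P; split.
- by rewrite /cover bigcup_setU !big_set1 setUCr.
- by apply/trivIsetP => C D; rewrite !inE => /orP[] /eqP -> /orP[] /eqP ->;
    rewrite ?eqxx // -setI_eq0 ?[~: A :&: A]setIC setICr.
- rewrite !inE negb_or eq_sym A0 /=; apply: contra AT => /eqP AC0.
  by rewrite -[A]setCK -AC0 setC0.
Qed.

(** The two points of an orbit have complementary dominating supports; conversely, a partition comes
    from the orbit of the indicator of either block. *)
Lemma supp_orbits_domatic :
  [set (@supp V) @: (O : {set {ffun V -> 'F_2}})
     | O in orbit_space (update e) (periodic_surj e)] = domatic_2_partitions e.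
Proof.
apply/setP => Q; apply/imsetP/domatic_2_partitionP => [[O /imsetP[s sP ->] ->]|].
  exists (supp s); rewrite orbit_update_periodic // imsetU1 imset_set1.
  rewrite supp_update_periodic //.
  by move: sP; rewrite periodic_surjE => /and4P[].
case=> A [A0 AT domA domAC ->]; pose s := indicator A.
have sP : s \in periodic_surj e.
  by rewrite periodic_surjE indicatorK; apply/and4P.
exists [set t in orbit (update e) s]; first exact: imset_f.
by rewrite orbit_update_periodic // imsetU1 imset_set1 supp_update_periodic //
  indicatorK.
Qed.

(** * Existence of a domatic partition *)

Hypothesis e_irr : irreflexive e.

(** The first edge of a path from [v] to another vertex gives the neighbour. *)
Lemma no_isolated_vertex v : (1 < #|V|)%N -> exists u, e v u.
Proof.
case/card_gt1P=> x [y [_ _ xy]].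
have [w vw] : exists w, v != w.
  by case: (eqVneq v x) xy => [->|vx _]; [exists y | exists x].
case/connectP: (e_conn v w) => [[|u p] /=].
  by move=> _ wv; rewrite wv eqxx in vw.
by case/andP=> vu _ _; exists u.
Qed.

(** A maximal independent set dominates by maximality. Its complement dominates because each vertex
    of the set has a neighbour, which independence forces outside. *)
Lemma exists_domatic : (1 < #|V|)%N ->
  exists A, dominating e A /\ dominating e (~: A).
Proof.
move=> V_gt1.
pose indep (D : {set V}) := [forall x in D, forall y in D, ~~ e x y].
have indepP (D : {set V}) : reflect {in D &, forall x y, ~~ e x y} (indep D).
  apply: (iffP forall_inP) => iD x => [y xD yD|xD].
    exact: (forall_inP (iD x xD)).
  by apply/forall_inP => y; apply: iD.
have [A /maxsetP[/indepP iA maxA]] : {A | maxset indep A}.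
  by apply: ex_maxset; exists set0; apply/indepP => x y; rewrite inE.
exists A; split; apply/forallP => v; apply/implyP; last first.
  rewrite inE negbK => vA; have [u vu] := no_isolated_vertex v V_gt1.
  apply/exists_inP; exists u => //; rewrite inE.
  by apply: contraTN vu => uA; apply: iA.
(* Without a neighbour in [A], the vertex [v] could be added to [A] and independence would
   survive. *)
move=> vA; apply: contraNT vA => /exists_inPn noedge.
rewrite -(maxA (v |: A)) ?subsetUr ?setU11 //; apply/indepP => x y.
rewrite !inE => /orP[/eqP->|xA] /orP[/eqP->|yA]; rewrite ?e_irr ?noedge //.
  by rewrite e_sym noedge.
exact: iA.
Qed.

(** On a single vertex every configuration is constant, hence the bound on [#|V|]. *)
Lemma periodic_surj_neq0 : (1 < #|V|)%N -> periodic_surj e != set0.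
Proof.
move=> V_gt1; have [A [domA domAC]] := exists_domatic V_gt1.
have [v _] : exists v : V, true.
  by case/card_gt1P: V_gt1 => x _; exists x.
have dom_neq0 D : dominating e D -> D != set0.
  move/forallP/(_ v); apply: contraTneq => ->.
  by rewrite inE /=; apply/exists_inP => -[u]; rewrite inE.
apply/set0Pn; exists (indicator A); rewrite periodic_surjE indicatorK.
apply/and4P; split; rewrite ?dom_neq0 //.
by rewrite -(inj_eq (@setC_inj V)) setCT dom_neq0.
Qed.

End Step.

Theorem theorem3p7 (V : finType) (e : rel V)
    (e_sym : symmetric e) (e_irr : irreflexive e)
    (e_conn : forall x y : V, connect e x y) :
  [/\ (1 < #|V|)%N -> periodic_surj e != set0,
      forall s : {ffun V -> 'F_2},
        s \in periodic_surj e -> has_period (update e) s 2,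
      forall s : {ffun V -> 'F_2}, s \in periodic_surj e ->
        update e s \in periodic_surj e /\ update e (update e s) = s
    & one_to_one_correspondence
        (orbit_space (update e) (periodic_surj e)) (domatic_2_partitions e)].
Proof.
split=> [|s sP|s sP|].
- exact: periodic_surj_neq0.
- split=> //; first exact: update_involutive_periodic.
  case=> [|[|n]] // _ fix1.
  by have := update_neq_periodic e_sym e_conn sP; rewrite -[X in _ != X]fix1 eqxx.
- by split; [exact: update_periodic_surj | exact: update_involutive_periodic].
(* Taking images under the injective map [supp] is injective on all sets of configurations, in
   particular on orbits. *)
- exists (fun O : {set {ffun V -> 'F_2}} => (@supp V) @: O); split;
    last exact: supp_orbits_domatic.
  by move=> O1 O2 _ _; apply: imset_inj; apply: can_inj (@suppK V).
Qed.
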